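(* Let $M^2$ be a spacelike surface in $\mathbb R^4_1$ free of flat points and let $p\in M^2$. Two tangents $g_1$ and $g_2$ at $p$ are conjugate tangents of $M^2$ if and only if $g_1$ and $g_2$ are conjugate with respect to the indicatrix $\chi$ at $p$.
   Context: $\mathbb R^4_1$ is the four-dimensional Minkowski space with metric $\langle\,,\rangle$ of signature $(3,1)$, with a fixed orthonormal basis $e_1,e_2,e_3,e_4$, $e_1^2=e_2^2=e_3^2=1$, $e_4^2=-1$, giving the orientation. A surface $M^2: z=z(u,v)$, $(u,v)\in\mathcal D\subset\mathbb R^2$ (smooth immersion) is spacelike if the induced metric is Riemannian. Put $E=\langle z_u,z_u\rangle$, $F=\langle z_u,z_v\rangle$, $G=\langle z_v,z_v\rangle$, $W=\sqrt{EG-F^2}$. Choose a normal frame field $\{n_1,n_2\}$ with $\langle n_1,n_1\rangle=1$, $\langle n_2,n_2\rangle=-1$, $\langle n_1,n_2\rangle=0$, such that $\{z_u,z_v,n_1,n_2\}$ is positively oriented. Put $c_{11}^k=\langle z_{uu},n_k\rangle$, $c_{12}^k=\langle z_{uv},n_k\rangle$, $c_{22}^k=\langle z_{vv},n_k\rangle$ ($k=1,2$), $$\Delta_1=c_{11}^1c_{12}^2-c_{11}^2c_{12}^1,\quad \Delta_2=c_{11}^1c_{22}^2-c_{11}^2c_{22}^1,\quad \Delta_3=c_{12}^1c_{22}^2-c_{12}^2c_{22}^1,$$ $$L=\frac{2\Delta_1}{W},\quad M=\frac{\Delta_2}{W},\quad N=\frac{2\Delta_3}{W}.$$ A point is flat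 if $L=M=N=0$ there. A tangent $g$ at $p$ is the line spanned by a non-zero tangent vector $X=\lambda z_u+\mu z_v$. Two tangents $g_1:\lambda_1z_u+\mu_1z_v$ and $g_2:\lambda_2z_u+\mu_2z_v$ at $p$ are conjugate tangents of $M^2$ if $$\zeta_{g_1,g_2}=\frac{L\lambda_1\lambda_2+M(\lambda_1\mu_2+\mu_1\lambda_2)+N\mu_1\mu_2}{\sqrt{I(\lambda_1,\mu_1)}\sqrt{I(\lambda_2,\mu_2)}}=0,\qquad I(\lambda,\mu)=E\lambda^2+2F\lambda\mu+G\mu^2.$$ The normal curvature of $g$ is $\nu_g=\zeta_{g,g}$; $g$ is principal if $\zeta_{g,g^\bot}=0$, where $g^\bot$ is the tangent orthogonal to $g$. At every point there are two orthogonal principal tangents; their normal curvatures $\nu',\nu''$ are the principal normal curvatures (if all tangents at $p$ are principal, then $\nu'=\nu''$ is the common normal curvature and any pair of orthogonal tangents may be used). The indicatrix at $p$ is the curve in $T_pM^2$ $$\chi:\ \nu'X^2+\nu''Y^2=\varepsilon,\qquad \varepsilon=\pm1,$$ in coordinates $(X,Y)$ with respect to an orthonormal basis of $T_pM^2$ along principal tangents with normal curvatures $\nu',\nu''$. Two lines through the origin with directions $(X_1,Y_1)$, $(X_2,Y_2)$ are conjugate with respect to $\chi$ if $\nu'X_1X_2+\nu''Y_1Y_2=0$. *)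

(* Defs.v *)
From HB Require Import structures.
From mathcomp Require Import all_boot all_order all_algebra.
From mathcomp Require Import all_classical all_reals all_analysis.

Set Implicit Arguments.
Unset Strict Implicit.
Unset Printing Implicit Defensive.

Import Order.TTheory GRing.Theory Num.Theory.
Import numFieldNormedType.Exports.

Local Open Scope classical_set_scope.
Local Open Scope ring_scope.

(* Minkowski space is 'rV[R]_4 in coordinates with respect to the fixed
   orthonormal basis e_1, e_2, e_3, e_4 (indices 0, 1, 2, 3), so e_4 is the
   timelike vector. *)
Definition mink (R : realType) (x y : 'rV[R]_4) : R :=
  \sum_(i < 4) (-1) ^+ (i == 3%N :> nat) * (x 0 i * y 0 i).

(* Parameters (u, v) and tangent coordinates (lambda, mu) are both 'rV[R]_2. *)
Definition partial (R : realType) (k : nat) (i : 'I_2)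
    (f : 'rV[R]_2 -> 'rV[R]_k.+1) : 'rV[R]_2 -> 'rV[R]_k.+1 :=
  fun q => 'D_(delta_mx 0 i) f q.

(* C^infinity on D: every iterated partial derivative exists and is continuous
   at every point of D. *)
Definition smooth_on (R : realType) (k : nat) (D : set 'rV[R]_2)
    (f : 'rV[R]_2 -> 'rV[R]_k.+1) : Prop :=
  forall (s : seq 'I_2) (q : 'rV[R]_2), D q ->
    {for q, continuous (foldr (@partial R k) f s)} /\
    forall i : 'I_2, derivable (foldr (@partial R k) f s) q (delta_mx 0 i).

Section Surface.
Variables (R : realType) (z : 'rV[R]_2 -> 'rV[R]_4).
Implicit Types (p q d : 'rV[R]_2) (g h : {vspace 'rV[R]_4}).

Definition zu : 'rV[R]_2 -> 'rV[R]_4 := partial 0 z.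
Definition zv : 'rV[R]_2 -> 'rV[R]_4 := partial 1 z.
Definition zuu : 'rV[R]_2 -> 'rV[R]_4 := partial 0 zu.
Definition zuv : 'rV[R]_2 -> 'rV[R]_4 := partial 1 zu.
Definition zvv : 'rV[R]_2 -> 'rV[R]_4 := partial 1 zv.

Definition coefE p : R := mink (zu p) (zu p).
Definition coefF p : R := mink (zu p) (zv p).
Definition coefG p : R := mink (zv p) (zv p).
Definition coefW p : R := Num.sqrt (coefE p * coefG p - coefF p ^+ 2).

Definition first_form p d : R :=
  coefE p * d 0 0 ^+ 2 + 2 * coefF p * d 0 0 * d 0 1 + coefG p * d 0 1 ^+ 2.

Definition spacelike_surface (D : set 'rV[R]_2) : Prop :=
  [/\ open D, smooth_on D z,
      (forall q, D q -> free [:: zu q; zv q]) &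
      (forall q d, D q -> d != 0 -> 0 < first_form q d)].

Definition tangent_vector p d : 'rV[R]_4 := d 0 0 *: zu p + d 0 1 *: zv p.

Definition spanned_by p g d : Prop :=
  d != 0 /\ g = <[tangent_vector p d]>%VS.

Definition tangent_at p g : Prop := exists d, spanned_by p g d.

Definition orthogonal_lines g h : Prop :=
  forall x y, x \in g -> y \in h -> mink x y = 0.

Variables (n1 n2 : 'rV[R]_2 -> 'rV[R]_4).

Definition normal_frame (D : set 'rV[R]_2) : Prop :=
  [/\ smooth_on D n1, smooth_on D n2 &
   forall q, D q ->
     [/\ [/\ mink (zu q) (n1 q) = 0, mink (zv q) (n1 q) = 0,
             mink (zu q) (n2 q) = 0 & mink (zv q) (n2 q) = 0],
         [/\ mink (n1 q) (n1 q) = 1, mink (n2 q) (n2 q) = -1 &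
             mink (n1 q) (n2 q) = 0] &
         0 < \det (\matrix_(i < 4)
                     tnth [tuple zu q; zv q; n1 q; n2 q] i)]].

Definition Delta1 p : R :=
  mink (zuu p) (n1 p) * mink (zuv p) (n2 p) -
  mink (zuu p) (n2 p) * mink (zuv p) (n1 p).
Definition Delta2 p : R :=
  mink (zuu p) (n1 p) * mink (zvv p) (n2 p) -
  mink (zuu p) (n2 p) * mink (zvv p) (n1 p).
Definition Delta3 p : R :=
  mink (zuv p) (n1 p) * mink (zvv p) (n2 p) -
  mink (zuv p) (n2 p) * mink (zvv p) (n1 p).

Definition coefL p : R := 2 * Delta1 p / coefW p.
Definition coefM p : R := Delta2 p / coefW p.
Definition coefN p : R := 2 * Delta3 p / coefW p.

Definition flat_point p : Prop :=
  [/\ coefL p = 0, coefM p = 0 & coefN p = 0].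

Definition zeta p d1 d2 : R :=
  (coefL p * d1 0 0 * d2 0 0
   + coefM p * (d1 0 0 * d2 0 1 + d1 0 1 * d2 0 0)
   + coefN p * d1 0 1 * d2 0 1)
  / (Num.sqrt (first_form p d1) * Num.sqrt (first_form p d2)).

(* Rescaling d1 or d2 changes zeta p d1 d2 at most by a sign, and not at all
   when d1 = d2.  Hence the existentials below do not depend on the choice of
   spanning vectors. *)
Definition conjugate_tangents p g1 g2 : Prop :=
  exists d1 d2, [/\ spanned_by p g1 d1, spanned_by p g2 d2 &
                    zeta p d1 d2 = 0].

Definition has_normal_curvature p g (nu : R) : Prop :=
  exists2 d, spanned_by p g d & nu = zeta p d d.

Definition principal_tangent p g : Prop :=
  exists h, [/\ tangent_at p h, orthogonal_lines g h &
                conjugate_tangents p g h].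

End Surface.

(* The conic  nu1 X^2 + nu2 Y^2 = eps  in coordinates (X, Y) with respect to
   the pair of vectors (axis1, axis2).  It is kept as a record, since the point
   set (empty when nu1, nu2 < 0 < eps) need not determine the coefficients. *)
Record central_conic (R : realType) := CentralConic {
  axis1 : 'rV[R]_4;
  axis2 : 'rV[R]_4;
  nu1 : R;
  nu2 : R;
  eps : R
}.

Definition conic_vector (R : realType) (chi : central_conic R)
    (w : 'rV[R]_2) : 'rV[R]_4 :=
  w 0 0 *: axis1 chi + w 0 1 *: axis2 chi.

Definition conic_curve (R : realType) (chi : central_conic R) :
    set 'rV[R]_4 :=
  [set x | exists w : 'rV[R]_2, x = conic_vector chi w /\
             nu1 chi * w 0 0 ^+ 2 + nu2 chi * w 0 1 ^+ 2 = eps chi].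

Definition conic_direction (R : realType) (chi : central_conic R)
    (g : {vspace 'rV[R]_4}) (w : 'rV[R]_2) : Prop :=
  w != 0 /\ g = <[conic_vector chi w]>%VS.

Definition conic_conjugate (R : realType) (chi : central_conic R)
    (g1 g2 : {vspace 'rV[R]_4}) : Prop :=
  exists w1 w2 : 'rV[R]_2,
    [/\ conic_direction chi g1 w1, conic_direction chi g2 w2 &
        nu1 chi * w1 0 0 * w2 0 0 + nu2 chi * w1 0 1 * w2 0 1 = 0].

Definition indicatrix (R : realType) (z n1 n2 : 'rV[R]_2 -> 'rV[R]_4)
    (p : 'rV[R]_2) (chi : central_conic R) : Prop :=
  [/\ [/\ mink (axis1 chi) (axis1 chi) = 1, mink (axis2 chi) (axis2 chi) = 1 &
          mink (axis1 chi) (axis2 chi) = 0],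
      principal_tangent z n1 n2 p <[axis1 chi]>%VS /\
      principal_tangent z n1 n2 p <[axis2 chi]>%VS,
      has_normal_curvature z n1 n2 p <[axis1 chi]>%VS (nu1 chi) /\
      has_normal_curvature z n1 n2 p <[axis2 chi]>%VS (nu2 chi) &
      eps chi = 1 \/ eps chi = -1].

(* Main.v *)
Require Import Defs.
From HB Require Import structures.
From mathcomp Require Import all_boot all_order all_algebra.
From mathcomp Require Import all_classical all_reals all_analysis.
From mathcomp Require Import ring.

(** Everything takes place in the coordinates (lambda, mu) of the tangent plane,
    where both the first fundamental form (E, F, G) and the numerator of zeta
    (L, M, N) are symmetric bilinear forms, written [sform] below.

    Since the first form is positive definite, the map from coordinates to
    tangent vectors is injective and the denominator of zeta never vanishes.
    Hence two tangents are conjugate exactly when the form (L, M, N) vanishes on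
    some, equivalently on any, pair of spanning vectors
    ([conjugate_tangents_line]).  The unit vectors on the axes of the indicatrix
    have coordinates a1, a2 that form a basis orthonormal for (E, F, G)
    ([orthonormal_basis]).  In this basis the form (L, M, N) is diagonal: its
    diagonal entries are the two normal curvatures, because a1 and a2 are unit
    ([normal_curvature_line]), and its off-diagonal entry is zero, because the
    axes are principal and in a plane the line orthogonal to the first axis can
    only be the second one ([principal_axes_conjugate]).  So (L, M, N) evaluated
    on two tangents is precisely the polar form
    nu' X1 X2 + nu'' Y1 Y2 of the indicatrix ([sform_principal]), and the two
    notions of conjugacy are the vanishing of the same number. *)

Set Implicit Arguments.
Unset Strict Implicit.
Unset Printing Implicit Defensive.

Import Order.TTheory GRing.Theory Num.Theory.
Import numFieldNormedType.Exports.

Local Open Scope classical_set_scope.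
Local Open Scope ring_scope.

(** * Symmetric bilinear forms on coordinate vectors *)

Definition sform (R : realType) (A B C : R) (d e : 'rV[R]_2) : R :=
  A * d 0 0 * e 0 0 + B * (d 0 0 * e 0 1 + d 0 1 * e 0 0) + C * d 0 1 * e 0 1.

Definition comb (R : realType) (a1 a2 w : 'rV[R]_2) : 'rV[R]_2 :=
  w 0 0 *: a1 + w 0 1 *: a2.

Lemma sformZ (R : realType) (A B C k l : R) (d e : 'rV[R]_2) :
  sform A B C (k *: d) (l *: e) = k * l * sform A B C d e.
Proof. by rewrite /sform !mxE; ring. Qed.

Lemma sform0 (R : realType) (A B C : R) (e : 'rV[R]_2) : sform A B C 0 e = 0.
Proof. by rewrite /sform !mxE; ring. Qed.

Lemma sform_comb (R : realType) (A B C : R) (a1 a2 v w : 'rV[R]_2) :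
  sform A B C (comb a1 a2 v) (comb a1 a2 w) =
  v 0 0 * w 0 0 * sform A B C a1 a1
  + (v 0 0 * w 0 1 + v 0 1 * w 0 0) * sform A B C a1 a2
  + v 0 1 * w 0 1 * sform A B C a2 a2.
Proof. by rewrite /sform /comb !mxE; ring. Qed.

Lemma row2P (R : realType) (d e : 'rV[R]_2) :
  d 0 0 = e 0 0 -> d 0 1 = e 0 1 -> d = e.
Proof.
move=> h0 h1; apply/rowP => i.
case: (unliftP ord0 i) => [j ->|-> //].
by rewrite (ord1 j) (_ : lift _ _ = 1) //; apply/val_inj.
Qed.

(** The Gram determinant of a1, a2 is the discriminant of the form times the
    square of the coordinate determinant of (a1, a2), so that an orthonormal
    pair has non-zero determinant and Cramer's rule applies. *)
Lemma orthonormal_basis (R : realType) (A B C : R) (a1 a2 d : 'rV[R]_2) :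
  sform A B C a1 a1 = 1 -> sform A B C a2 a2 = 1 -> sform A B C a1 a2 = 0 ->
  exists w, d = comb a1 a2 w.
Proof.
move=> h11 h22 h12.
pose det (x y : 'rV[R]_2) := x 0 0 * y 0 1 - x 0 1 * y 0 0.
have gram : (A * C - B ^+ 2) * det a1 a2 ^+ 2 = 1.
  transitivity (sform A B C a1 a1 * sform A B C a2 a2 - sform A B C a1 a2 ^+ 2).
    by rewrite /sform /det; ring.
  by rewrite h11 h22 h12; ring.
have det0 : det a1 a2 != 0.
  apply/eqP => d0; move: gram; rewrite d0 expr0n /= mulr0 => /esym/eqP.
  by rewrite oner_eq0.
exists (\row_i (if i == 0 then det d a2 / det a1 a2 else det a1 d / det a1 a2)).
by move: det0; rewrite /det => det0; apply: row2P; rewrite /comb !mxE /=; field.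
Qed.

(** * Lines of the tangent plane *)

Lemma mink_tangent (R : realType) (z : 'rV[R]_2 -> 'rV[R]_4)
    (p d e : 'rV[R]_2) :
  mink (tangent_vector z p d) (tangent_vector z p e) =
  sform (Defs.coefE z p) (Defs.coefF z p) (Defs.coefG z p) d e.
Proof.
rewrite /sform /Defs.coefE /Defs.coefF /Defs.coefG /tangent_vector /mink.
move: (zu z p) (zv z p) => a b.
rewrite !mulr_suml -!big_split /=.
by apply: eq_bigr => i _; rewrite !mxE; move: ((-1) ^+ _) => s; ring.
Qed.

Lemma first_formE (R : realType) (z : 'rV[R]_2 -> 'rV[R]_4) (p d : 'rV[R]_2) :
  first_form z p d =
  sform (Defs.coefE z p) (Defs.coefF z p) (Defs.coefG z p) d d.
Proof. by rewrite /first_form /sform; ring. Qed.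

Lemma tangent_vectorZ (R : realType) (z : 'rV[R]_2 -> 'rV[R]_4)
    (p d : 'rV[R]_2) (k : R) :
  tangent_vector z p (k *: d) = k *: tangent_vector z p d.
Proof.
rewrite /tangent_vector; move: (zu z p) (zv z p) => b1 b2.
by rewrite !mxE scalerDr !scalerA.
Qed.

Lemma tangent_vector_comb (R : realType) (z : 'rV[R]_2 -> 'rV[R]_4)
    (p a1 a2 w : 'rV[R]_2) :
  tangent_vector z p (comb a1 a2 w) =
  w 0 0 *: tangent_vector z p a1 + w 0 1 *: tangent_vector z p a2.
Proof.
rewrite /tangent_vector /comb; move: (zu z p) (zv z p) => b1 b2.
by apply/rowP => i; rewrite !mxE; ring.
Qed.

Lemma tangent_vector_inj (R : realType) (z : 'rV[R]_2 -> 'rV[R]_4)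
    (p : 'rV[R]_2) (pos : forall d, d != 0 -> 0 < first_form z p d) :
  injective (tangent_vector z p).
Proof.
move=> d e deE; apply/eqP; rewrite -subr_eq0; apply/negP => /negP /pos.
have -> : first_form z p (d - e) = 0; last by rewrite ltxx.
rewrite first_formE -mink_tangent.
have -> : tangent_vector z p (d - e) = 0.
  transitivity (tangent_vector z p d - tangent_vector z p e).
    rewrite /tangent_vector; move: (zu z p) (zv z p) => b1 b2.
    by apply/rowP => i; rewrite !mxE; ring.
  by rewrite deE subrr.
by rewrite /mink big1 // => i _; rewrite !mxE !mul0r mulr0.
Qed.

Lemma spanned_by_scale (R : realType) (z : 'rV[R]_2 -> 'rV[R]_4)
    (p : 'rV[R]_2) (pos : forall d, d != 0 -> 0 < first_form z p d)
    (g : {vspace 'rV[R]_4}) (d e : 'rV[R]_2) :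
  spanned_by z p g d -> spanned_by z p g e -> exists2 k, k != 0 & e = k *: d.
Proof.
move=> [_ gd] [e0 ge].
have : tangent_vector z p e \in g by rewrite ge memv_line.
rewrite gd => /vlineP[k].
rewrite -tangent_vectorZ => /(tangent_vector_inj pos) ek.
by exists k => //; apply: contra_neq e0 => k0; rewrite ek k0 scale0r.
Qed.

(** The denominator of zeta is non-zero, and rescaling the spanning vectors
    rescales its numerator by a non-zero factor. *)
Lemma conjugate_tangents_line (R : realType) (z n1 n2 : 'rV[R]_2 -> 'rV[R]_4)
    (p : 'rV[R]_2) (pos : forall d, d != 0 -> 0 < first_form z p d)
    (g1 g2 : {vspace 'rV[R]_4}) (d1 d2 : 'rV[R]_2) :
  spanned_by z p g1 d1 -> spanned_by z p g2 d2 ->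
  conjugate_tangents z n1 n2 p g1 g2 <->
  sform (Defs.coefL z n1 n2 p) (Defs.coefM z n1 n2 p) (Defs.coefN z n1 n2 p)
        d1 d2 = 0.
Proof.
move=> s1 s2; split=> [[e1 [e2 [t1 t2]]]|s0]; last first.
  exists d1, d2; split=> //.
  by move: s0; rewrite /sform /zeta => ->; rewrite mul0r.
have [k k0 ek] := spanned_by_scale pos s1 t1.
have [l l0 el] := spanned_by_scale pos s2 t2.
rewrite /zeta -/(sform _ _ _ e1 e2) => /eqP.
rewrite mulf_eq0 invr_eq0 mulf_eq0 !sqrtr_eq0 !leNgt.
rewrite !pos ?(proj1 t1, proj1 t2) //=.
by rewrite orbF ek el sformZ !mulf_eq0 (negPf k0) (negPf l0) => /eqP.
Qed.

(** On the diagonal the two square roots multiply to the first form, so zeta is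
    a quotient of quadratic forms and does not depend on the spanning vector. *)
Lemma normal_curvature_line (R : realType) (z n1 n2 : 'rV[R]_2 -> 'rV[R]_4)
    (p : 'rV[R]_2) (pos : forall d, d != 0 -> 0 < first_form z p d)
    (g : {vspace 'rV[R]_4}) (d : 'rV[R]_2) (nu : R) :
  spanned_by z p g d -> has_normal_curvature z n1 n2 p g nu ->
  nu = sform (Defs.coefL z n1 n2 p) (Defs.coefM z n1 n2 p) (Defs.coefN z n1 n2 p)
             d d
       / first_form z p d.
Proof.
move=> s [e t ->]; have [k k0 ek] := spanned_by_scale pos s t.
have I0 := pos _ (proj1 s).
rewrite /zeta -/(sform _ _ _ e e) -expr2 sqr_sqrtr; last first.
  by apply/ltW/pos; apply: (proj1 t).
rewrite ek first_formE !sformZ -first_formE.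
by field; rewrite k0 gt_eqF.
Qed.

Lemma unit_vector_coords (R : realType) (z : 'rV[R]_2 -> 'rV[R]_4)
    (p : 'rV[R]_2) (x : 'rV[R]_4) :
  mink x x = 1 -> tangent_at z p <[x]>%VS ->
  exists2 a, spanned_by z p <[x]>%VS a & x = tangent_vector z p a.
Proof.
move=> x1 [d [d0 xd]].
have : x \in <[tangent_vector z p d]>%VS by rewrite -xd memv_line.
case/vlineP => k; rewrite -tangent_vectorZ => xk.
exists (k *: d) => //; split; last by rewrite -xk.
apply/eqP => kd0; move/eqP: x1; rewrite xk mink_tangent kd0 sform0.
by rewrite eq_sym oner_eq0.
Qed.

(** * The second form in principal axes *)

(** The definition of a principal tangent only provides some line orthogonal to
    the first axis; expanding its direction in the basis (a1, a2) shows that it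
    is a multiple of a2. *)
Lemma principal_axes_conjugate (R : realType)
    (z n1 n2 : 'rV[R]_2 -> 'rV[R]_4) (p : 'rV[R]_2)
    (pos : forall d, d != 0 -> 0 < first_form z p d)
    (g : {vspace 'rV[R]_4}) (a1 a2 : 'rV[R]_2) :
  let I := sform (Defs.coefE z p) (Defs.coefF z p) (Defs.coefG z p) in
  I a1 a1 = 1 -> I a2 a2 = 1 -> I a1 a2 = 0 ->
  spanned_by z p g a1 -> principal_tangent z n1 n2 p g ->
  sform (Defs.coefL z n1 n2 p) (Defs.coefM z n1 n2 p) (Defs.coefN z n1 n2 p)
        a1 a2 = 0.
Proof.
move=> I h11 h22 h12 s1 [h [[b sb] gh]].
move/(conjugate_tangents_line n1 n2 pos s1 sb).
have [w bw] := orthonormal_basis b h11 h22 h12.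
have a1E : a1 = comb a1 a2 (delta_mx 0 0).
  by rewrite /comb !mxE /= scale1r scale0r addr0.
have w0 : w 0 0 = 0.
  have: I a1 b = 0.
    rewrite /I -mink_tangent; apply: gh.
      by rewrite (proj2 s1) memv_line.
    by rewrite (proj2 sb) memv_line.
  rewrite {1}a1E bw /I sform_comb -!/(I _ _) h11 h22 h12 !mxE /=.
  by rewrite !mul1r !mul0r !mulr0 mulr1 !addr0.
have w1 : w 0 1 != 0.
  by apply: contra_neq (proj1 sb) => w1; rewrite bw /comb w0 w1 !scale0r addr0.
have -> : b = w 0 1 *: a2 by rewrite bw /comb w0 scale0r add0r.
rewrite -[a1 in sform _ _ _ a1 _]scale1r sformZ mul1r => /eqP.
by rewrite mulf_eq0 (negPf w1) => /eqP.
Qed.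

(** The coordinates a1, a2 of the axes identify the plane of the indicatrix with
    the (lambda, mu)-plane, and this identification carries the polar form of
    the indicatrix to the numerator of zeta: principality of the axes removes
    the mixed term, and their unit length makes the normal curvatures the two
    remaining coefficients. *)
Lemma sform_principal (R : realType) (z n1 n2 : 'rV[R]_2 -> 'rV[R]_4)
    (p : 'rV[R]_2) (pos : forall d, d != 0 -> 0 < first_form z p d)
    (chi : central_conic R) (hchi : indicatrix z n1 n2 p chi) :
  exists a1 a2 : 'rV[R]_2,
  [/\ forall w, conic_vector chi w = tangent_vector z p (comb a1 a2 w),
      forall d, exists w, d = comb a1 a2 w,
      forall w, (comb a1 a2 w == 0) = (w == 0) &
      forall v w,
        sform (Defs.coefL z n1 n2 p) (Defs.coefM z n1 n2 p)
              (Defs.coefN z n1 n2 p)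
              (comb a1 a2 v) (comb a1 a2 w) =
        nu1 chi * v 0 0 * w 0 0 + nu2 chi * v 0 1 * w 0 1].
Proof.
case: hchi => -[x11 x22 x12] [pr1 pr2] [c1 c2] _.
have tan g : principal_tangent z n1 n2 p g -> tangent_at z p g.
  by case=> h [_ _ [d [_ [s _ _]]]]; exists d.
have [a1 s1 x1] := unit_vector_coords x11 (tan _ pr1).
have [a2 s2 x2] := unit_vector_coords x22 (tan _ pr2).
rewrite x1 mink_tangent in x11; rewrite x2 mink_tangent in x22.
rewrite x1 x2 mink_tangent in x12.
have S12 := principal_axes_conjugate pos x11 x22 x12 s1 pr1.
have nu1E := normal_curvature_line pos s1 c1.
have nu2E := normal_curvature_line pos s2 c2.
rewrite first_formE x11 divr1 in nu1E; rewrite first_formE x22 divr1 in nu2E.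
exists a1, a2; split.
- by move=> w; rewrite /conic_vector x1 x2 tangent_vector_comb.
- by move=> d; apply: orthonormal_basis x11 x22 x12.
- move=> w; apply/eqP/eqP => [w0|->]; last by rewrite /comb !mxE !scale0r addr0.
  (* The squared length of a combination of orthonormal vectors is the sum of
     the squares of its coefficients. *)
  have := sform_comb (Defs.coefE z p) (Defs.coefF z p) (Defs.coefG z p)
            a1 a2 w w.
  rewrite x11 x22 x12 w0 sform0 mulr0 addr0 !mulr1.
  move/esym/eqP; rewrite paddr_eq0 -?expr2 ?sqr_ge0 // !sqrf_eq0.
  by case/andP => /eqP w00 /eqP w01; apply: row2P; rewrite !mxE.
- by move=> v w; rewrite sform_comb S12 -nu1E -nu2E; ring.
Qed.

(** * Conjugate tangents and the indicatrix *)

Theorem proposition3p4 (R : realType) (D : set 'rV[R]_2)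
    (z n1 n2 : 'rV[R]_2 -> 'rV[R]_4)
    (hz : spacelike_surface z D)
    (hn : normal_frame z n1 n2 D)
    (hflat : forall q : 'rV[R]_2, D q -> ~ flat_point z n1 n2 q)
    (p : 'rV[R]_2) (hp : D p)
    (chi : central_conic R) (hchi : indicatrix z n1 n2 p chi)
    (g1 g2 : {vspace 'rV[R]_4})
    (hg1 : tangent_at z p g1) (hg2 : tangent_at z p g2) :
  conjugate_tangents z n1 n2 p g1 g2 <-> conic_conjugate chi g1 g2.
Proof.
have pos d : d != 0 -> 0 < first_form z p d by case: hz => _ _ _ /(_ p d hp).
have [a1 [a2 [cvE basis comb0 polar]]] := sform_principal pos hchi.
case: hg1 hg2 => d1 s1 [d2 s2].
split=> [/(conjugate_tangents_line n1 n2 pos s1 s2)|].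
  have [w1 d1E] := basis d1; have [w2 d2E] := basis d2.
  rewrite d1E d2E polar => conj0; exists w1, w2; split=> //.
    by case: s1; rewrite d1E comb0 /conic_direction cvE.
  by case: s2; rewrite d2E comb0 /conic_direction cvE.
case=> w1 [w2 [[w10 g1E] [w20 g2E]]]; rewrite -polar.
by apply: (conjugate_tangents_line _ _ pos _ _).2;
  split; rewrite ?comb0 -?cvE.
Qed.
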